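(* Let $n\ge1$ and $(\pi,u)\in\operatorname{Vert}(C_n)$. Then $\operatorname{dinv}'_C(\pi,u)=\operatorname{area}'(\zeta_C(\pi),d_C(\pi,u))$.
   Context: $\mathcal L_{n,n}$: words in $\{N,E\}$ with $n$ of each letter; $\mathcal B_{2n}$: words of length $2n$ whose prefixes have at least as many $N$'s as $E$'s. Rise $i$: the $i$-th $N$ is immediately followed by $N$. Valley $(i,j)$: the $i$-th $E$ is immediately followed by the $j$-th $N$; also $(i,j+1)$ if a ballot path with $i$ East and $j$ North steps ends with an East step. For $a\in\mathbb Z^n$, $j\ge0$: $\overrightarrow{S}^+_j(a)$ reads $a$ left to right writing $N$ for entries $j$ and $E$ for entries $j+1$; $\overleftarrow{S}^+_j(a)$ reads right to left; $\overrightarrow{S}^-_j,\overleftarrow{S}^-_j$ likewise with $N$ for $-j$, $E$ for $-j-1$. $\mathfrak S_n^C$: bijections $u$ of $\{\pm1,\dots,\pm n\}$ with $u(-i)=-u(i)$, acting on $\mathbb R^n$ by $u\cdot e_i=e_{u(i)}$, $e_{-i}=-e_i$. For $\pi\in\mathcal L_{n,n}$: $\lambda_i$ = number of $E$'s before the $i$-th $N$; $\mu_i=(n+1-i)-\lambda_{n+1-i}$; $\zeta_C(\pi)=\overleftarrow{S}^-_n(\mu)\overrightarrow{S}^+_n(\mu)\cdots\overleftarrow{S}^-_0(\mu)\overrightarrow{S}^+_0(\mu)$. $\operatorname{Vert}(C_n)$: pairs $(\pi,u)$, $u\in\mathfrak S_n^C$, $u(i)<u(i+1)$ for each rise $i$,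 $u(1)>0$ if $\pi$ begins with $N$. $d_C(\pi,u)\in\mathfrak S_n^C$: for $i=0,\dots,n$ write $-u(j)$ for $j$ with $\mu_{n+1-j}=-i$ in decreasing order of $j$, then $u(j)$ for $j$ with $\mu_{n+1-j}=i+1$ in increasing order of $j$; this sequence is the window. Root poset $C_n$: $\Phi^+=\{\pm e_i+e_j:i<j\}\cup\{2e_i\}$, $\alpha\le\beta$ iff $\beta-\alpha$ is a sum of positive roots. For $\beta\in\mathcal B_{2n}$: $\alpha_{i,j}=e_{n+1-i}-e_{n+1-j}$ ($j\le n$), $e_{n+1-i}+e_{j-n}$ ($j>n$) for valleys $(i,j)$; $A_\beta$ the set of these; $I_\beta=\{x\in\Phi^+:$ no $y\in A_\beta$ with $y\le x\}$; $\operatorname{area}'(\beta,w)=\#\{x\in I_\beta: w\cdot x\in\Phi^+\}$. $\operatorname{dinv}'_C(\pi,u)$ is the sum of: $\#\{(i,j):i<j,\mu_{n-i+1}=\mu_{n-j+1},u(i)<u(j)\}$, $\#\{(i,j):i<j,\mu_{n-i+1}=\mu_{n-j+1}+1,u(i)>u(j)\}$, $\#\{(i,j):i<j,\mu_{n-i+1}=-\mu_{n-j+1},u(i)<-u(j)\}$, $\#\{(i,j):i<j,\mu_{n-i+1}=-\mu_{n-j+1}+1,u(i)>-u(j)\}$, and $\#\{i:\mu_{n-i+1}=0,u(i)<0\}$, with $i,j\in[n]$. *)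

(* Defs.v *)
From HB Require Import structures.
From mathcomp Require Import all_boot all_order all_algebra.
From mathcomp Require Import finmap.
From mathcomp Require Import mathcomp_extra boolp classical_sets functions.

Set Implicit Arguments.
Unset Strict Implicit.
Unset Printing Implicit Defensive.

Import Order.TTheory GRing.Theory Num.Theory.
Local Open Scope ring_scope.

(* All indices below (of letters, entries, windows, coordinates, rises and
   valleys) are 1-based natural numbers, as in the combinatorial literature. *)

(** * Lattice words *)

Inductive step := North | East.

Definition is_north (a : step) : bool := if a is North then true else false.
Definition step_of_bool (b : bool) : step := if b then North else East.
Lemma is_northK : cancel is_north step_of_bool. Proof. by case. Qed.
HB.instance Definition _ := Equality.copy step (can_type is_northK).

Definition lattice_word (n : nat) (pi : seq step) : bool :=
  (count_mem North pi == n) && (count_mem East pi == n).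

(* 0-based position in [s] of the [i]-th letter [a]; meaningful for
   1 <= i <= count_mem a s. *)
Definition pos (a : step) (s : seq step) (i : nat) : nat :=
  nth 0%N [seq k <- iota 0 (size s) | nth East s k == a] i.-1.

Definition rise (pi : seq step) (i : nat) : bool :=
  (0 < i <= count_mem North pi)%N && (nth East pi (pos North pi i).+1 == North).

(* The second part is the extra valley of a word ending with an East step. *)
Definition valleys (b : seq step) : seq (nat * nat) :=
  [seq v <- [seq (i, j) | i <- iota 1 (count_mem East b),
                          j <- iota 1 (count_mem North b)]
    | pos North b v.2 == (pos East b v.1).+1]
  ++ (if last North b == East
      then [:: (count_mem East b, (count_mem North b).+1)] else [::]).

(** * The zeta map *)

Definition lam (pi : seq step) (i : nat) : nat :=
  count_mem East (take (pos North pi i) pi).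

(* [i] ranges over 1..n, so the natural subtraction is never truncated. *)
Definition mu (n : nat) (pi : seq step) (i : nat) : int :=
  (n.+1 - i)%N%:Z - (lam pi (n.+1 - i))%:Z.

Definition mu_seq (n : nat) (pi : seq step) : seq int :=
  [seq mu n pi i | i <- iota 1 n].

(* Reads [a] from left to right, writing N for [x] and E for [y]. *)
Definition read_word (x y : int) (a : seq int) : seq step :=
  [seq (if c == x then North else East) | c <- a & (c == x) || (c == y)].

Definition S_fwd_plus (j : nat) (a : seq int) := read_word j%:Z j.+1%:Z a.
Definition S_bwd_plus (j : nat) (a : seq int) := read_word j%:Z j.+1%:Z (rev a).
Definition S_fwd_minus (j : nat) (a : seq int) :=
  read_word (- j%:Z) (- j%:Z - 1) a.
Definition S_bwd_minus (j : nat) (a : seq int) :=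
  read_word (- j%:Z) (- j%:Z - 1) (rev a).

Definition zetaC (n : nat) (pi : seq step) : seq step :=
  flatten [seq S_bwd_minus j (mu_seq n pi) ++ S_fwd_plus j (mu_seq n pi)
          | j <- rev (iota 0 n.+1)].

(** * Signed permutations and vertically labelled paths *)

Definition signed_range (n : nat) : set int :=
  [set i : int | (i != 0) && (`|i| <= n)%N]%classic.

(* A signed permutation is given as a function on [int], of which only the
   values on {+-1, ..., +-n} matter. *)
Definition signed_perm (n : nat) (u : int -> int) : Prop :=
  set_bij (signed_range n) (signed_range n) u
  /\ (forall i : int, signed_range n i -> u (- i) = - u i).

Definition VertC (n : nat) (pi : seq step) (u : int -> int) : Prop :=
  [/\ lattice_word n pi,
      signed_perm n u,
      forall i : nat, rise pi i -> u i%:Z < u i.+1%:Z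
    & head East pi = North -> 0 < u 1].

(* The odd function with window [s], that is, i |-> s_i for 1 <= i <= size s. *)
Definition of_window (s : seq int) (i : int) : int :=
  match i with
  | Posz 0 => 0
  | Posz k.+1 => nth 0 s k
  | Negz k => - nth 0 s k
  end.

Definition dC_window (n : nat) (pi : seq step) (u : int -> int) : seq int :=
  flatten
    [seq [seq - u j%:Z | j <- rev (iota 1 n) & mu n pi (n.+1 - j) == - i%:Z]
         ++ [seq u j%:Z | j <- iota 1 n & mu n pi (n.+1 - j) == i.+1%:Z]
    | i <- iota 0 n.+1].

Definition dC (n : nat) (pi : seq step) (u : int -> int) : int -> int :=
  of_window (dC_window n pi u).

(** * The root poset of type C, in the lattice Z^n of R^n *)

(* e_i for i in {+-1, ..., +-n}, with e_{-i} = - e_i. *)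
Definition e (n : nat) (i : int) : 'rV[int]_n :=
  \row_(k < n) ((i == k.+1%:Z)%:R - (i == - k.+1%:Z)%:R).

Definition act (n : nat) (w : int -> int) (x : 'rV[int]_n) : 'rV[int]_n :=
  \sum_(k < n) x 0 k *: e n (w k.+1%:Z).

Definition pos_roots (n : nat) : {fset 'rV[int]_n} :=
  ([fset (e n j%:Z - e n i%:Z)%R | i in iota 1 n, j in iota 1 n & (i < j)%N]
   `|` [fset (e n j%:Z + e n i%:Z)%R | i in iota 1 n, j in iota 1 n & (i < j)%N]
   `|` [fset (e n i%:Z *+ 2)%R | i in iota 1 n])%fset.

(* The empty sum is allowed, so this is reflexive. *)
Definition root_le (n : nat) (x y : 'rV[int]_n) : Prop :=
  exists2 s : seq 'rV[int]_n,
    {subset s <= pos_roots n} & y - x = \sum_(r <- s) r.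

(** * Area and dinv statistics *)

Definition alpha (n i j : nat) : 'rV[int]_n :=
  if (j <= n)%N then e n (n.+1 - i)%N%:Z - e n (n.+1 - j)%N%:Z
  else e n (n.+1 - i)%N%:Z + e n (j - n)%N%:Z.

Definition valley_roots (n : nat) (b : seq step) : {fset 'rV[int]_n} :=
  [fset alpha n v.1 v.2 | v in valleys b]%fset.

Definition order_ideal (n : nat) (b : seq step) : {fset 'rV[int]_n} :=
  [fset x in pos_roots n |
    `[< ~ exists2 y, y \in valley_roots n b & root_le y x >]]%fset.

Definition area' (n : nat) (b : seq step) (w : int -> int) : nat :=
  #|` [fset x in order_ideal n b | act w x \in pos_roots n]%fset |.

(* Number of pairs 1 <= i < j <= n satisfying [P]. *)
Definition num_pairs (n : nat) (P : nat -> nat -> bool) : nat :=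
  #|[set p : 'I_n.+1 * 'I_n.+1 | (0 < p.1 < p.2)%N && P p.1 p.2]|.

Definition dinvC' (n : nat) (pi : seq step) (u : int -> int) : nat :=
  let m (i : nat) : int := mu n pi (n - i + 1)%N in
  let d1 := num_pairs n (fun i j => (m i == m j) && (u i%:Z < u j%:Z)) in
  let d2 := num_pairs n (fun i j => (m i == m j + 1) && (u i%:Z > u j%:Z)) in
  let d3 := num_pairs n (fun i j => (m i == - m j) && (u i%:Z < - u j%:Z)) in
  let d4 := num_pairs n (fun i j => (m i == - m j + 1) && (u i%:Z > - u j%:Z)) in
  let d5 := #|[set i : 'I_n.+1 | [&& (0 < i)%N, m i == 0 & u (i : nat)%:Z < 0]]| in
  (d1 + d2 + d3 + d4 + d5)%N.

(* Main.v *)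
(* Put m i = mu_{n+1-i}, N = 2n+1, and extend m to a level on the signed indices
   {+-1, ..., +-n} by level(-i) = 1 - m i. The integers key x = level x * N + x
   encode the lexicographic order on (level x, x) and satisfy
   key(-x) = N - key x; the extended window of d_C lists u(x) by increasing key.
   A pair (x, y) attacks if key x < key y < key x + N and u x < u y; dinv'_C
   counts attacking pairs up to (x, y) ~ (-y, -x), one orbit at a time.

   On the other side, reading the integers downwards, with a North step at key x
   and an East step at key x - N, gives a bi-infinite word antisymmetric about 0,
   and zeta_C is its restriction to the positive integers. Comparing a root with
   the roots of the valleys thus amounts to asking whether the i-th East step
   precedes the j-th North step, so the order ideal consists of the roots of the
   pairs with key x < key y < key x + N. The sign of the image of such a root
   under d_C is that of u y - u x, whence area' counts the same orbits, with
   other representatives. *)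

Require Import Defs.
From mathcomp Require Import all_boot all_order all_algebra.
From mathcomp Require Import finmap boolp zify ring.

Set Implicit Arguments.
Unset Strict Implicit.
Unset Printing Implicit Defensive.

Import Order.TTheory GRing.Theory Num.Theory.
Local Open Scope ring_scope.

(** * Roots of type C *)

Definition signed_index (n : nat) (x : int) : bool := (x != 0) && (`|x| <= n)%N.

Lemma signed_indexN n x : signed_index n (- x) = signed_index n x.
Proof. by rewrite /signed_index oppr_eq0 abszN. Qed.

Lemma eN n (i : int) : e n (- i) = - e n i.
Proof.
apply/rowP => k; rewrite !mxE opprB; congr (_%:R - _%:R); first by rewrite eqr_oppLR.
by rewrite eqr_opp.
Qed.

(* Linear functionals and [act] alike are sums over coordinates, so both are
   evaluated on [e n a] by this lemma. *)
Lemma sum_coord_e n (V : lmodType int) (g : int -> V) (a : int) :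
  (forall i : nat, (0 < i <= n)%N -> g (- i%:Z) = - g i%:Z) ->
  signed_index n a ->
  \sum_(k < n) e n a 0 k *: g k.+1%:Z = g a.
Proof.
move=> gN /andP[a0 an].
have key (b : nat) : (0 < b <= n)%N ->
    \sum_(k < n) e n b%:Z 0 k *: g k.+1%:Z = g b%:Z.
  case: b => // b bn; have bn' : (b < n)%N by [].
  rewrite (bigD1 (Ordinal bn')) //= big1 ?addr0.
    by rewrite !mxE eqxx (_ : (b.+1%:Z == - _) = false) ?subr0 ?scale1r //; lia.
  move=> k kb; rewrite !mxE.
  have -> : (b.+1%:Z == k.+1%:Z) = false.
    by apply/negP => /eqP [bk]; case/eqP: kb; apply: val_inj.
  rewrite (_ : (b.+1%:Z == - _) = false) ?subrr ?scale0r //; lia.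
have [b ab] : exists b : nat, a = b%:Z \/ a = - b%:Z.
  by exists `|a|%N; lia.
case: ab an a0 => -> an a0; first by apply: key; lia.
rewrite gN; last by lia.
rewrite -key; last by lia.
by rewrite -sumrN; apply: eq_bigr => k _; rewrite eN mxE scaleNr.
Qed.

Lemma act_e n (w : int -> int) (a : int) :
  (forall i : nat, (0 < i <= n)%N -> w (- i%:Z) = - w i%:Z) ->
  signed_index n a -> act w (e n a) = e n (w a).
Proof.
move=> wN sa; rewrite /act (sum_coord_e (g := fun i => e n (w i))) // => i ni.
by rewrite wN // eN.
Qed.

Lemma actB n (w : int -> int) (x y : 'rV[int]_n) : act w (x - y) = act w x - act w y.
Proof.
rewrite /act -sumrB; apply: eq_bigr => k _.
by rewrite !mxE scalerBl.
Qed.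

Definition coord_form n (c : int -> int) (x : 'rV[int]_n) : int :=
  \sum_(k < n) x 0 k * c k.+1%:Z.

Lemma coord_form_e n (c : int -> int) (a : int) :
  (forall i, c (- i) = - c i) -> signed_index n a -> coord_form c (e n a) = c a.
Proof.
move=> cN sa; rewrite -[RHS](@sum_coord_e n int^o c a) //.
Qed.

Lemma coord_formB n c (x y : 'rV[int]_n) :
  coord_form c (x - y) = coord_form c x - coord_form c y.
Proof. by rewrite /coord_form -sumrB; apply: eq_bigr => k _; rewrite !mxE mulrBl. Qed.

Lemma coord_form_sum n c (s : seq 'rV[int]_n) :
  coord_form c (\sum_(r <- s) r) = \sum_(r <- s) coord_form c r.
Proof.
elim: s => [|r s IH]; first by rewrite !big_nil /coord_form big1 // => k _; rewrite mxE mul0r.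
rewrite !big_cons -IH /coord_form -big_split; apply: eq_bigr => k _.
by rewrite !mxE mulrDl.
Qed.

(** With e_{-i} = -e_i the three families of positive roots become one: [a = -i] gives e_i + e_j for
    [b = j] and 2 e_i for [b = i]. *)
Lemma pos_rootsP n (x : 'rV[int]_n) :
  reflect (exists a b : int, [/\ signed_index n a, signed_index n b, a < b & x = e n b - e n a])
          (x \in pos_roots n).
Proof.
apply: (iffP idP).
  case/fsetUP => [/fsetUP[]|].
  - case/imfset2P => i; rewrite /= mem_iota => i1 [j]; rewrite inE /= mem_iota => /andP[j1 ij] ->.
    by exists i%:Z, j%:Z; split=> //; rewrite /signed_index; lia.
  - case/imfset2P => i; rewrite /= mem_iota => i1 [j]; rewrite inE /= mem_iota => /andP[j1 ij] ->.
    by exists (- i%:Z), j%:Z; split; rewrite ?eN ?opprK // /signed_index; lia.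
  - case/imfsetP => i; rewrite /= mem_iota => i1 ->.
    by exists (- i%:Z), i%:Z; split; rewrite ?eN ?opprK // /signed_index; lia.
move=> [a [b [sa sb ab ->]]].
have iotaI (i : int) : signed_index n i -> `|i|%N \in iota 1 n.
  by rewrite /signed_index mem_iota; lia.
have ia := iotaI _ sa; have ib := iotaI _ sb.
have e_abs (i : int) : e n i = if 0 < i then e n `|i|%N%:Z else - e n `|i|%N%:Z.
  by case: ifP => i0; rewrite -?eN; congr (e n _); lia.
rewrite (e_abs a) (e_abs b); move: sa sb; rewrite /signed_index => sa sb.
(* Since [a < b], the index of larger absolute value has a forced sign: positive for [b], negative
   for [a]. Equality means [a = - b]. *)
have [ab0|ab0|ab0] := ltngtP `|a|%N `|b|%N.
- have -> : 0 < b by lia.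
  case: ifP => a0; rewrite ?opprK; apply/fsetUP; left; apply/fsetUP; [left|right].
    by apply/imfset2P; exists `|a|%N => //; exists `|b|%N => //; rewrite inE /= ib.
  by apply/imfset2P; exists `|a|%N => //; exists `|b|%N => //; rewrite inE /= ib.
- have -> : (0 < a) = false by lia.
  rewrite opprK.
  case: ifP => b0; apply/fsetUP; left; apply/fsetUP; [right|left].
    by apply/imfset2P; exists `|b|%N => //; exists `|a|%N => //; [rewrite inE /= ia | rewrite addrC].
  by apply/imfset2P; exists `|b|%N => //; exists `|a|%N => //; [rewrite inE /= ia | rewrite addrC].
- have -> : (0 < a) = false by lia.
  have -> : 0 < b by lia.
  rewrite opprK ab0 -mulr2n; apply/fsetUP; right.
  by apply/imfsetP; exists `|b|%N.
Qed.

Lemma coord_form_diff n c (a b : int) : (forall i, c (- i) = - c i) ->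
  signed_index n a -> signed_index n b -> coord_form c (e n b - e n a) = c b - c a.
Proof. by move=> cN sa sb; rewrite coord_formB !coord_form_e. Qed.

Lemma mem_pos_roots_diff n (a b : int) : signed_index n a -> signed_index n b ->
  (e n b - e n a \in pos_roots n) = (a < b).
Proof.
move=> sa sb; apply/idP/idP => [/pos_rootsP[a' [b' [sa' sb' ab' eq_ab]]]|ab].
  have := congr1 (coord_form id) eq_ab.
  rewrite !coord_form_diff //; lia.
by apply/pos_rootsP; exists a, b.
Qed.

(** For [t > 0] this is an odd step function, and [coord_form (threshold t)] sums the coordinates of
    index at least [t]; for [t <= n] it is, up to scaling, a fundamental coweight. *)
Definition threshold (t x : int) : int := (t <= x)%R%:R - (x <= - t)%R%:R.

Lemma thresholdN (t x : int) : threshold t (- x) = - threshold t x.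
Proof. by rewrite /threshold opprB; congr (_%:R - _%:R); lia. Qed.

Lemma threshold_ge (t x : int) : 0 < t -> t <= x -> threshold t x = 1.
Proof.
by move=> t0 tx; rewrite /threshold tx (_ : (x <= - t) = false) ?subr0 //; lia.
Qed.

Lemma threshold_lt (t x : int) : x < t -> threshold t x = - (x <= - t)%R%:R.
Proof. by rewrite ltNge /threshold => /negbTE ->; rewrite sub0r. Qed.

(** Each failure is refuted at one [t]: at [q] if [q' < q]; if [p < p'], at the smaller of [p'] and
    [q] when [p'] is positive and at [- p] when it is negative. The condition [- p <= q] fixes one
    of the two representations e_q - e_p = e_{-p} - e_{-q} of a root. *)
Lemma threshold_inj (p q p' q' : int) : p != 0 -> p' != 0 -> p < q -> - p <= q ->
  p' < q' -> - p' <= q' ->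
  (forall t, 0 < t -> threshold t q - threshold t p <= threshold t q' - threshold t p') ->
  (q <= q') && (p' <= p).
Proof.
move=> p0 p'0 pq npq pq' npq' le_t; apply/andP; split; rewrite leNgt; apply/negP => lt.
  have := le_t q ltac:(lia).
  rewrite threshold_ge //; last by lia.
  rewrite (threshold_lt pq) (threshold_lt lt) (threshold_lt (lt_trans pq' lt)).
  rewrite (_ : (p' <= - q) = false); last by lia.
  by case: (p <= - q); case: (q' <= - q); lia.
have [p'_gt0|p'_lt0] := boolP (0 < p').
  have [p'q|qp'] := leP p' q.
    have := le_t p' p'_gt0.
    rewrite (threshold_ge p'_gt0 p'q) (threshold_lt lt) (threshold_ge p'_gt0 (ltW pq')).
    by rewrite threshold_ge //; case: (p <= - p'); lia.
  have q0 : 0 < q by lia.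
  have := le_t q q0.
  rewrite (threshold_ge q0 (lexx q)) (threshold_lt pq) (threshold_ge q0 (ltW qp')).
  rewrite threshold_ge //; last by lia.
  by case: (p <= - q); lia.
have t0 : 0 < - p by lia.
have := le_t (- p) t0.
rewrite (threshold_ge t0 npq) (threshold_lt (_ : p < - p)); last by lia.
rewrite [X in _ <= _ - X]threshold_lt; last by lia.
rewrite !opprK lexx (_ : (p' <= p) = false); last by lia.
by rewrite /threshold; case: (- p <= q'); case: (q' <= - - p); lia.
Qed.

Lemma root_le_threshold n (t : int) (x y : 'rV[int]_n) : 0 < t -> root_le x y ->
  coord_form (threshold t) x <= coord_form (threshold t) y.
Proof.
move=> t0 [s s_pos] /(congr1 (coord_form (threshold t))).
rewrite coord_formB coord_form_sum => eq_s; rewrite -subr_ge0 eq_s big_seq.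
apply: sumr_ge0 => r /s_pos /pos_rootsP[a [b [sa sb ab ->]]].
rewrite coord_form_diff //; last exact: thresholdN.
rewrite /threshold; lia.
Qed.

(* [rank_pos n k] is the position, in the window extended to -n, ..., -1, 1,
   ..., n, of its [k]-th entry from the right. *)
Definition rank_pos (n k : nat) : int :=
  if (k <= n)%N then n%:Z + 1 - k%:Z else n%:Z - k%:Z.

Lemma signed_index_rank_pos n k : (0 < k <= n.*2)%N -> signed_index n (rank_pos n k).
Proof. rewrite /signed_index /rank_pos; case: ifP; lia. Qed.

Lemma rank_pos_lt n i j : (i < j)%N -> rank_pos n j < rank_pos n i.
Proof. by rewrite /rank_pos; do 2 case: ifP; lia. Qed.

Lemma rank_posN n i : (0 < i <= n.*2)%N -> rank_pos n (n.*2.+1 - i) = - rank_pos n i.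
Proof. by rewrite /rank_pos; do 2 case: ifP; lia. Qed.

Lemma alphaE n i j : (0 < i <= n)%N -> (0 < j <= n.*2)%N ->
  alpha n i j = e n (rank_pos n i) - e n (rank_pos n j).
Proof.
move=> i_n j_n; rewrite /alpha /rank_pos; have -> : (i <= n)%N by lia.
case: ifP => jn; first by congr (e n _ - e n _); lia.
have -> : n%:Z - j%:Z = - (j - n)%N%:Z by lia.
by rewrite eN opprK; congr (e n _ + e n _); lia.
Qed.

(* Every positive root is [alpha n i j] for exactly one pair of this kind. *)
Definition cell (n i j : nat) : bool := (0 < i < j)%N && (i + j <= n.*2.+1)%N.

Lemma alpha_cellE n i j : cell n i j ->
  [/\ signed_index n (rank_pos n i), signed_index n (rank_pos n j),
     rank_pos n j < rank_pos n i & alpha n i j = e n (rank_pos n i) - e n (rank_pos n j)].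
Proof.
rewrite /cell => cij; split.
- by apply: signed_index_rank_pos; lia.
- by apply: signed_index_rank_pos; lia.
- by apply: rank_pos_lt; lia.
- by apply: alphaE; lia.
Qed.

Lemma alpha_pos_root n i j : cell n i j -> alpha n i j \in pos_roots n.
Proof. by move=> /alpha_cellE[si sj ij ->]; rewrite mem_pos_roots_diff. Qed.

Lemma rank_pos_onto n a : signed_index n a -> exists2 i, (0 < i <= n.*2)%N & a = rank_pos n i.
Proof.
rewrite /signed_index => sa.
exists (if 0 < a then `|(n%:Z + 1 - a)%R|%N else `|(n%:Z - a)%R|%N); first by case: ifP; lia.
by rewrite /rank_pos; do 2 case: ifP; lia.
Qed.

(** A root e_b - e_a is also e_{-a} - e_{-b}, and negation sends position [k] to [2n + 1 - k]; one
    of the two representations therefore has [i + j <= 2n + 1]. *)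
Lemma pos_rootsE n (x : 'rV[int]_n) :
  reflect (exists2 ij, cell n ij.1 ij.2 & x = alpha n ij.1 ij.2) (x \in pos_roots n).
Proof.
apply: (iffP idP) => [|[ij cij ->]]; last exact: alpha_pos_root.
case/pos_rootsP => a [b [sa sb ab ->]].
have [i i_n ai] := rank_pos_onto sa; have [j j_n bj] := rank_pos_onto sb.
have ji : (j < i)%N.
  rewrite ltnNge leq_eqVlt; apply/negP => /orP[/eqP ij|/(@rank_pos_lt n)]; last by lia.
  by move: ab; rewrite ai bj ij ltxx.
case: (leqP (i + j) n.*2.+1) => ij_n.
  exists (j, i); first by rewrite /cell /=; lia.
  by rewrite /= alphaE; [rewrite ai bj|lia|lia].
exists (n.*2.+1 - i, n.*2.+1 - j)%N; first by rewrite /cell /=; lia.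
rewrite /= alphaE; [|lia|lia].
rewrite !rank_posN ?i_n ?j_n // !eN opprK ai bj addrC //.
Qed.

(** The threshold functionals give one direction. Conversely, writing e_k for the vector at position
    [k], the difference is (e_{i'} - e_i) + (e_j - e_{j'}), where each bracket is zero or a positive
    root. *)
Lemma root_le_alpha n i j i' j' : cell n i j -> cell n i' j' ->
  root_le (alpha n i j) (alpha n i' j') <-> (i' <= i)%N /\ (j <= j')%N.
Proof.
move=> cij cij'.
have [si sj ij eij] := alpha_cellE cij; have [si' sj' ij' eij'] := alpha_cellE cij'.
split=> [le_ij|[ii jj]].
  have le_t t : 0 < t -> threshold t (rank_pos n i) - threshold t (rank_pos n j)
       <= threshold t (rank_pos n i') - threshold t (rank_pos n j').
    move=> t0; have := root_le_threshold t0 le_ij.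
    by rewrite eij eij' !coord_form_diff //; apply: thresholdN.
  have : (rank_pos n i <= rank_pos n i') && (rank_pos n j' <= rank_pos n j).
    apply: threshold_inj le_t => //.
    - by case/andP: sj.
    - by case/andP: sj'.
    - by move: cij; rewrite /cell /rank_pos; do 2 case: ifP; lia.
    - by move: cij'; rewrite /cell /rank_pos; do 2 case: ifP; lia.
  move=> /andP[]; rewrite !leNgt => ii jj.
  by split; rewrite leqNgt; apply: contraNN ii + apply: contraNN jj; apply: rank_pos_lt.
have step (a b : nat) : (0 < a <= b)%N -> (b <= n.*2)%N -> exists2 s : seq 'rV[int]_n,
    {subset s <= pos_roots n} & e n (rank_pos n a) - e n (rank_pos n b) = \sum_(r <- s) r.
  move=> ab bn; case: (ltngtP a b) => [lt_ab||->]; last by exists [::]; rewrite ?big_nil ?subrr.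
    exists [:: e n (rank_pos n a) - e n (rank_pos n b)]; last by rewrite big_seq1.
    move=> r; rewrite inE => /eqP ->; rewrite mem_pos_roots_diff ?rank_pos_lt //.
      by apply: signed_index_rank_pos; lia.
    by apply: signed_index_rank_pos; lia.
  by lia.
have [s s_pos es] := step i' i ltac:(move: cij'; rewrite /cell; lia) ltac:(move: cij; rewrite /cell; lia).
have [s' s'_pos es'] := step j j' ltac:(move: cij; rewrite /cell; lia) ltac:(move: cij'; rewrite /cell; lia).
exists (s ++ s'); first by move=> r; rewrite mem_cat => /orP[/s_pos|/s'_pos].
rewrite big_cat /= -es -es' eij eij'.
rewrite opprB addrACA [X in _ = X]addrACA [X in _ = _ + X]addrC.
by congr (_ + _); rewrite addrC.
Qed.

Lemma alpha_inj n i j i' j' : cell n i j -> cell n i' j' ->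
  alpha n i j = alpha n i' j' -> i = i' /\ j = j'.
Proof.
move=> cij cij' eq_a.
have refl (x : 'rV[int]_n) : root_le x x by exists [::] => //; rewrite big_nil subrr.
have /(root_le_alpha cij cij')[] : root_le (alpha n i j) (alpha n i' j') by rewrite eq_a.
have /(root_le_alpha cij' cij)[] : root_le (alpha n i' j') (alpha n i j) by rewrite eq_a.
by lia.
Qed.

(** * Lattice words and their valleys *)

Lemma pairwise_flatten_map (S T : eqType) (r : rel T) (q : rel S) (B : S -> seq T) (s : seq S) :
  pairwise q s ->
  (forall i, i \in s -> pairwise r (B i)) ->
  (forall i j x y, q i j -> x \in B i -> y \in B j -> r x y) ->
  pairwise r (flatten [seq B i | i <- s]).
Proof.
move=> qs rB rq; elim: s qs rB => //= i s IH /andP[/allP qi qs] rB.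
rewrite pairwise_cat rB ?mem_head ?IH ?andbT //; last by move=> j sj; rewrite rB // inE sj orbT.
apply/allrelP => x y xi /flatten_mapP[j /qi qij yj]; exact: rq qij xi yj.
Qed.

Lemma pairwise_rev (T : Type) (r : rel T) s : pairwise r (rev s) = pairwise (fun x y => r y x) s.
Proof. by elim: s => //= x s IH; rewrite rev_cons pairwise_rcons all_rev IH. Qed.

Lemma pairwise_iota a k : pairwise ltn (iota a k).
Proof. by rewrite -sorted_pairwise ?iota_ltn_sorted //; exact: ltn_trans. Qed.

Lemma count_downset0 (T : Type) (P : pred T) (x : T) (s : seq T) :
  all (fun y => P y ==> P x) s -> ~~ P x -> count P s = 0%N.
Proof.
move=> Px /negbTE Pxb; apply/eqP; rewrite -leqn0 leqNgt -has_count -all_predC.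
by apply: sub_all Px => y /=; rewrite Pxb implybF.
Qed.

(** The hypothesis places the elements satisfying [P] first. It will hold for a lower bound on the
    keys in a list of decreasing keys. *)
Lemma filter_downset (T : Type) (P : pred T) (s : seq T) :
  pairwise (fun x y => P y ==> P x) s -> filter P s = take (count P s) s.
Proof.
elim: s => //= x s IH /andP[Px ps]; case: ifPn => Pxb; first by rewrite /= IH.
by rewrite IH // (count_downset0 Px) // take0.
Qed.

Lemma ltn_count_downset (T : Type) (x0 : T) (P : pred T) (s : seq T) k :
  pairwise (fun x y => P y ==> P x) s ->
  (k < count P s)%N = (k < size s)%N && P (nth x0 s k).
Proof.
elim: s k => //= x s IH k /andP[Px ps]; case: (boolP (P x)) => Pxb.
  by case: k => [|k]; rewrite add1n /= !ltnS ?IH.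
rewrite (count_downset0 Px) // ltn0; case: k => [|k] /=; first by rewrite (negbTE Pxb).
by rewrite ltnS -IH // (count_downset0 Px).
Qed.

(** For the zeta word, [s] lists the integers at which steps occur, and this recovers the integer of
    the [i]-th step of a given kind. *)
Lemma pos_filter (T : Type) (d : T) (f : T -> step) (s : seq T) a i :
  (0 < i <= count (fun t => f t == a) s)%N ->
  nth d s (pos a (map f s) i) = nth d [seq t <- s | f t == a] i.-1.
Proof.
move=> i_s; have Es : s = map (nth d s) (iota 0 (size s)).
  by rewrite -[in LHS](mkseq_nth d s).
have E : [seq k <- iota 0 (size s) | f (nth d s k) == a] =
         [seq k <- iota 0 (size (map f s)) | nth East (map f s) k == a].
  rewrite size_map; apply: eq_in_filter => k; rewrite mem_iota add0n => /andP[_ ks].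
  by rewrite (nth_map d).
have S : size [seq k <- iota 0 (size s) | f (nth d s k) == a] = count (fun t => f t == a) s.
  by rewrite size_filter -[in RHS](mkseq_nth d s) count_map.
rewrite [X in filter _ X]Es filter_map (nth_map 0%N); first by rewrite /pos -E.
by rewrite /= S; lia.
Qed.

Section Positions.

Variables (a : step) (b : seq step).

Let letters := [seq k <- iota 0 (size b) | nth East b k == a].

Lemma size_letters : size letters = count_mem a b.
Proof. by rewrite size_filter -[in RHS](mkseq_nth East b) count_map. Qed.

Lemma pos_mem i : (0 < i <= count_mem a b)%N -> (pos a b i < size b)%N /\ nth East b (pos a b i) = a.
Proof.
rewrite -size_letters => ib; have /(mem_nth 0%N) : (i.-1 < size letters)%N by lia.
rewrite -/(pos a b i).
by rewrite mem_filter mem_iota => /andP[/eqP pa /andP[_ ps]].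
Qed.

Lemma pos_lt i j : (0 < i < j)%N -> (j <= count_mem a b)%N -> (pos a b i < pos a b j)%N.
Proof.
rewrite -size_letters => ij jb.
have /(pairwiseP 0%N) : pairwise ltn letters.
  apply: pairwise_filter; exact: pairwise_iota.
by move=> /(_ i.-1 j.-1); apply; rewrite ?inE; lia.
Qed.

Lemma pos_le i j : (0 < i)%N -> (j <= count_mem a b)%N -> (i <= j)%N -> (pos a b i <= pos a b j)%N.
Proof.
move=> i0 jb; rewrite leq_eqVlt => /orP[/eqP->|ij] //; apply/ltnW/pos_lt => //; lia.
Qed.

Lemma pos_onto k : (k < size b)%N -> nth East b k = a ->
  exists2 i, (0 < i <= count_mem a b)%N & pos a b i = k.
Proof.
move=> kb ka; have kl : k \in letters by rewrite mem_filter ka eqxx mem_iota.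
exists (index k letters).+1; first by rewrite -size_letters ltnS index_mem.
by rewrite /pos /= nth_index.
Qed.

End Positions.

Lemma mem_valleys (b : seq step) i j : reflect
  ([/\ (0 < i <= count_mem East b)%N, (0 < j <= count_mem North b)%N
      & pos North b j = (pos East b i).+1] \/
   [/\ last North b = East, i = count_mem East b & j = (count_mem North b).+1])
  ((i, j) \in valleys b).
Proof.
rewrite mem_cat mem_filter /=; apply: (iffP orP) => -[].
- move=> /andP[/eqP pij /allpairsP[[i' j'] [/=]]].
  by rewrite !mem_iota => i1 j1 [ei ej]; subst; left; split; lia.
- by case: eqP => // lE; rewrite inE => /eqP[-> ->]; right.
- case=> i1 j1 pij; left; rewrite pij eqxx; apply/allpairsP; exists (i, j).
  by rewrite /= !mem_iota; split=> //; lia.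
- by case=> -> -> ->; right; rewrite eqxx inE.
Qed.

(** The first North step after the [i]-th East step is, by minimality, not preceded by a North step,
    so it closes a valley. If no North step follows, the word ends with an East step and the extra
    valley serves. *)
Lemma valley_below (b : seq step) i j : (0 < i <= count_mem East b)%N -> (0 < j)%N ->
  ((j <= count_mem North b)%N -> (pos East b i < pos North b j)%N) ->
  exists i' j', [/\ (i', j') \in valleys b, (i <= i')%N & (j' <= j)%N].
Proof.
move=> ib j0 pij; have [ps nE] := pos_mem ib.
have disj k k' : nth East b k = East -> nth East b k' = North -> k <> k'.
  by move=> kE k'N kk; rewrite kk k'N in kE.
have [[j1 /andP[j1b pj1]]|none] := pselect (exists j1,
    (0 < j1 <= count_mem North b)%N && (pos East b i < pos North b j1)%N); last first.
  exists (count_mem East b), (count_mem North b).+1; split; [|lia|].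
    apply/mem_valleys; right; split=> //.
    case lb: (last North b) => //; case: none.
    have b0 : (0 < size b)%N by lia.
    have nl : nth East b (size b).-1 = North.
      by move: lb; rewrite -nth_last; case: (b) b0 => //= x s _; rewrite (set_nth_default East).
    have lt_b : ((size b).-1 < size b)%N by lia.
    have [j1 j1b pj1] := pos_onto lt_b nl.
    exists j1; rewrite j1b /= pj1; have := disj _ _ nE nl; lia.
  rewrite ltnNge; apply/negP => jb; apply: none; exists j; rewrite pij //; lia.
have ex1 : exists j1, (0 < j1 <= count_mem North b)%N && (pos East b i < pos North b j1)%N.
  by exists j1; rewrite j1b.
case: (ex_minnP ex1) => j2 /andP[j2b pj2] j2min.
have [p2s n2] := pos_mem j2b.
have kb : ((pos North b j2).-1 < size b)%N by lia.
case lk: (nth East b (pos North b j2).-1).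
  have [j3 j3b pj3] := pos_onto kb lk.
  have j32 : (j3 < j2)%N.
    rewrite ltnNge; apply/negP => j23.
    by have := @pos_le North b j2 j3 ltac:(lia) ltac:(lia) j23; lia.
  have := j2min j3; rewrite j3b /= pj3; have := disj _ _ nE lk; lia.
have [i' i'b pi'] := pos_onto kb lk.
exists i', j2; split.
- by apply/mem_valleys; left; split=> //; lia.
- rewrite leqNgt; apply/negP => i'i.
  by have := @pos_lt East b i' i ltac:(lia) ltac:(lia); lia.
- case: (leqP j (count_mem North b)) => jb; last by lia.
  by apply: j2min; rewrite pij // andbT; lia.
Qed.

(** * The order on signed indices *)

(** As [x] and [y] differ by at most [2n], they only break ties between [a] and [b]. *)
Lemma lex_lt (n : nat) (a b x y : int) : (`|x| <= n)%N -> (`|y| <= n)%N ->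
  (a * n.*2.+1%:Z + x < b * n.*2.+1%:Z + y) = (a < b) || ((a == b) && (x < y)).
Proof.
move=> xn yn; case: (ltgtP a b) => [ab|ba|->] /=; last by rewrite ltrD2l.
- nia.
- nia.
Qed.

Lemma lex_eq (n : nat) (a b x y : int) : (`|x| <= n)%N -> (`|y| <= n)%N ->
  a * n.*2.+1%:Z + x = b * n.*2.+1%:Z + y -> a = b /\ x = y.
Proof.
move=> xn yn eq_ab.
have := lex_lt a b xn yn; have := lex_lt b a yn xn; rewrite eq_ab ltxx; lia.
Qed.

Section SignedOrder.

Variables (n : nat) (m : nat -> int).
Hypothesis m_bound : forall i, (0 < i <= n)%N -> (`|m i| <= n)%N.

Local Notation N := (n.*2.+1%:Z).

Definition level (x : int) : int := if 0 < x then m `|x|%N else 1 - m `|x|%N.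

Definition key (x : int) : int := level x * N + x.

Definition sidx : seq int :=
  [seq - j%:Z | j <- rev (iota 1 n)] ++ [seq j%:Z | j : nat <- iota 1 n].

Lemma mem_sidx x : (x \in sidx) = signed_index n x.
Proof.
rewrite mem_cat /signed_index; apply/idP/idP.
  by case/orP => /mapP[j]; rewrite ?mem_rev mem_iota => jn ->; lia.
move=> xn; case: (ltP 0 x) => x0; apply/orP; [right|left].
  by apply/mapP; exists `|x|%N; rewrite ?mem_iota; lia.
by apply/mapP; exists `|x|%N; rewrite ?mem_rev ?mem_iota; lia.
Qed.

Lemma sidx_sorted : pairwise <%R sidx.
Proof.
rewrite pairwise_cat; apply/and3P; split.
- apply/allrelP => x y /mapP[j]; rewrite mem_rev mem_iota => jn -> /mapP[k].
  by rewrite mem_iota => kn ->; lia.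
- rewrite pairwise_map pairwise_rev; apply: sub_pairwise (pairwise_iota 1 n).
  by move=> x y /=; lia.
- by rewrite pairwise_map; apply: sub_pairwise (pairwise_iota 1 n) => x y /=; lia.
Qed.

Lemma levelN x : signed_index n x -> level (- x) = 1 - level x.
Proof.
rewrite /signed_index /level abszN => sx.
by case: (ltP 0 x) => x0; [rewrite (_ : 0 < - x = false) | rewrite (_ : 0 < - x)]; lia.
Qed.

Lemma keyN x : signed_index n x -> key (- x) = N - key x.
Proof. by move=> sx; rewrite /key levelN //; ring. Qed.

Lemma key_lt x y : signed_index n x -> signed_index n y ->
  (key x < key y) = (level x < level y) || ((level x == level y) && (x < y)).
Proof. by move=> /andP[_ xn] /andP[_ yn]; rewrite /key lex_lt. Qed.

Lemma key_inj x y : signed_index n x -> signed_index n y -> key x = key y -> x = y.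
Proof. by move=> /andP[_ xn] /andP[_ yn] /lex_eq[]. Qed.

(** A multiple of [N] could only be the key of the excluded index 0. With [c = 1], exactly one of
    [N < key x] and [0 < key (- x)] holds. *)
Lemma key_neq x c : signed_index n x -> key x != c * N.
Proof.
move=> /andP[x0 xn]; apply/eqP; rewrite -[c * N]addr0 => /lex_eq[] // _ xe.
by rewrite xe in x0.
Qed.

Lemma mem_key (a x : int) : signed_index n x ->
  (a * N + x \in [seq key y | y <- sidx]) = (level x == a).
Proof.
move=> sx; apply/mapP/eqP => [[y]|<-]; last by exists x => //; rewrite mem_sidx.
rewrite mem_sidx /key => sy; case/andP: (sx) (sy) => _ xn /andP[_ yn].
by move=> /lex_eq[] // -> ->.
Qed.

(** * The window of d_C and the ranking of signed indices by decreasing key *)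

Definition window : seq int :=
  flatten [seq [seq x <- sidx | level x == i.+1%:Z] | i <- iota 0 n.+1].

Lemma window_sorted : pairwise (fun x y => key x < key y) window.
Proof.
apply: (pairwise_flatten_map (q := ltn)).
- exact: pairwise_iota.
- move=> i _; apply: (sub_in_pairwise (P := [pred x | signed_index n x && (level x == i.+1%:Z)]) (r := <%R)).
  + by move=> x y /andP[sx /eqP lx] /andP[sy /eqP ly] xy; rewrite key_lt // lx ly eqxx xy orbT.
  + by apply/allP => x; rewrite mem_filter mem_sidx /= andbC.
  + exact: pairwise_filter sidx_sorted.
move=> i j x y ij; rewrite !mem_filter !mem_sidx => /andP[/eqP lx sx] /andP[/eqP ly sy].
by rewrite key_lt // lx ly; apply/orP; left; lia.
Qed.

(** Only negative indices can reach level [n + 1], which is why blocks 0 to [n] exhaust the positive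
    integers carrying a step. *)
Lemma level_bound x : signed_index n x -> level x <= if 0 < x then n%:Z else n.+1%:Z.
Proof.
rewrite /signed_index /level => sx; have := m_bound (_ : (0 < `|x| <= n)%N).
by case: ifP => x0; move=> /(_ ltac:(lia)); lia.
Qed.

(** The reflection [key (- x) = N - key x] is centred at [N / 2]: a positive level puts the key at
    [n + 1] or above, any other at [n] or below. *)
Lemma key_half x : signed_index n x -> (0 < level x) = (N < key x *+ 2).
Proof.
rewrite /key => /andP[x0 xn]; rewrite mulr2n; apply/idP/idP => lx; last by nia.
by nia.
Qed.

Lemma mem_window x : (x \in window) = signed_index n x && (0 < level x).
Proof.
apply/flatten_mapP/andP => [[i]|[sx lx]].
  by rewrite mem_iota mem_filter mem_sidx => _ /andP[/eqP -> ->].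
have lb : level x <= n.+1%:Z by move: (level_bound sx); case: ifP; lia.
exists `|level x|.-1%N; first by rewrite mem_iota; lia.
by rewrite mem_filter mem_sidx sx andbT; lia.
Qed.

(** The extended window of d_C, before [u] is applied, read from right to left. *)
Definition ranking : seq int := rev window ++ [seq - x | x <- window].

Lemma mem_ranking x : (x \in ranking) = signed_index n x.
Proof.
rewrite mem_cat mem_rev mem_window; have [sx|sx] /= := boolP (signed_index n x).
  have [//|lx] /= := boolP (0 < level x).
  apply/mapP; exists (- x); rewrite ?opprK // mem_window signed_indexN sx levelN //=.
  by lia.
by apply/mapP => -[y]; rewrite mem_window => /andP[sy _] xy; rewrite xy signed_indexN sy in sx.
Qed.

Lemma ranking_sorted : pairwise (fun x y => key y < key x) ranking.
Proof.
rewrite pairwise_cat; apply/and3P; split.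
- apply/allrelP => x y; rewrite mem_rev mem_window => /andP[sx lx] /mapP[z].
  rewrite mem_window => /andP[sz lz] ->; rewrite keyN //.
  by move: lx lz; rewrite !key_half //; lia.
- by rewrite pairwise_rev; exact: window_sorted.
- rewrite pairwise_map; apply: (sub_in_pairwise (P := signed_index n) (r := fun x y => key x < key y)); last exact: window_sorted.
    by move=> x y sx sy /= xy; rewrite !keyN //; lia.
  by apply/allP => x; rewrite mem_window => /andP[].
Qed.

Lemma uniq_ranking : uniq ranking.
Proof.
by apply: (@pairwise_uniq _ (fun x y => key y < key x)); [move=> x; rewrite /= ltxx|exact: ranking_sorted].
Qed.

Lemma uniq_sidx : uniq sidx.
Proof. by apply: (@pairwise_uniq _ <%R); [exact: ltxx|exact: sidx_sorted]. Qed.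

Lemma size_sidx : size sidx = n.*2.
Proof. by rewrite size_cat !size_map size_rev size_iota addnn. Qed.

Lemma size_ranking : size ranking = n.*2.
Proof.
rewrite -size_sidx; apply/eqP; rewrite eqn_leq; apply/andP; split.
  by apply: uniq_leq_size uniq_ranking _ => x; rewrite mem_ranking mem_sidx.
by apply: uniq_leq_size uniq_sidx _ => x; rewrite mem_ranking mem_sidx.
Qed.

Lemma size_window : size window = n.
Proof.
apply: double_inj; rewrite -size_ranking [RHS](size_cat (rev window)) size_rev size_map.
by rewrite addnn.
Qed.

(* The signed index with the [k]-th largest key; junk unless 1 <= k <= 2n. *)
Definition ranked (k : nat) : int := nth 0 ranking k.-1.

Definition rank (x : int) : nat := (index x ranking).+1.

Lemma ranked_signed k : (0 < k <= n.*2)%N -> signed_index n (ranked k).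
Proof. by move=> kn; rewrite -mem_ranking mem_nth // size_ranking; lia. Qed.

Lemma rank_bound x : signed_index n x -> (0 < rank x <= n.*2)%N.
Proof. by rewrite -mem_ranking -index_mem size_ranking /rank. Qed.

Lemma rankK x : signed_index n x -> ranked (rank x) = x.
Proof. by rewrite -mem_ranking => sx; rewrite /ranked nth_index. Qed.

Lemma rankedK k : (0 < k <= n.*2)%N -> rank (ranked k) = k.
Proof. by move=> kn; rewrite /rank index_uniq ?uniq_ranking ?size_ranking; lia. Qed.

Lemma ranked_lt i j : (0 < i)%N -> (j <= n.*2)%N -> (i < j)%N -> key (ranked j) < key (ranked i).
Proof.
move=> i0 jn ij; have /(pairwiseP 0) := ranking_sorted; apply; rewrite ?inE ?size_ranking; lia.
Qed.

Lemma ranked_le i j : (0 < i <= n.*2)%N -> (0 < j <= n.*2)%N ->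
  (key (ranked j) <= key (ranked i)) = (i <= j)%N.
Proof.
move=> i0 jn; case: (leqP i j) => ij.
  move: ij; rewrite leq_eqVlt => /orP[/eqP ->|ij]; first exact: lexx.
  by apply/ltW/ranked_lt => //; lia.
by apply/negbTE; rewrite -ltNge; apply: ranked_lt; lia.
Qed.

Lemma rank_le x y : signed_index n x -> signed_index n y -> (rank x <= rank y)%N = (key y <= key x).
Proof. by move=> sx sy; rewrite -[in RHS](rankK sx) -[in RHS](rankK sy) ranked_le ?rank_bound. Qed.

Lemma rankedN k : (0 < k <= n.*2)%N -> ranked (n.*2.+1 - k) = - ranked k.
Proof.
have small i : (0 < i <= n)%N -> ranked (n.*2.+1 - i) = - ranked i.
  move=> i_n; rewrite /ranked /ranking !nth_cat !size_rev size_window.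
  have -> : ((n.*2.+1 - i).-1 < n)%N = false by lia.
  have -> : (i.-1 < n)%N by lia.
  rewrite (nth_map 0) ?nth_rev size_window; [|lia|lia].
  by congr (- nth _ _ _); lia.
move=> kn; case: (leqP k n) => k_n; first by apply: small; lia.
have := small (n.*2.+1 - k)%N ltac:(lia).
by rewrite (_ : n.*2.+1 - (n.*2.+1 - k) = k)%N ?[ranked k]/1 => [->|]; [rewrite opprK|lia].
Qed.

Lemma rankN x : signed_index n x -> rank (- x) = (n.*2.+1 - rank x)%N.
Proof.
by move=> sx; have rx := rank_bound sx; rewrite -{1}(rankK sx) -rankedN // rankedK //; lia.
Qed.

(** Shows that d_C sends the basis vector at position [k] to e_{u(ranked k)}, so the sign of the
    image of a root is read off [u]. *)
Lemma window_rank_pos (u : int -> int) k : (forall x, signed_index n x -> u (- x) = - u x) ->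
  (0 < k <= n.*2)%N -> of_window [seq u x | x <- window] (rank_pos n k) = u (ranked k).
Proof.
move=> uN kn; rewrite /rank_pos /ranked nth_cat size_rev size_window.
have nth_signed i : (i < n)%N -> signed_index n (nth 0 window i).
  move=> i_n; have : nth 0 window i \in window by rewrite mem_nth ?size_window.
  by rewrite mem_window => /andP[].
case: (leqP k n) => k_n.
  rewrite (_ : n%:Z + 1 - k%:Z = (n - k).+1%:Z); last by lia.
  have -> : (k.-1 < n)%N by lia.
  rewrite /= (nth_map 0) ?nth_rev ?size_window; [|lia|lia].
  by congr (u (nth _ _ _)); lia.
rewrite (_ : n%:Z - k%:Z = - (k - n).-1.+1%:Z); last by lia.
have -> : (k.-1 < n)%N = false by lia.
rewrite /= !(nth_map 0) ?size_window; [|lia|lia].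
by rewrite uN; [congr (- u (nth _ _ _)); lia | apply: nth_signed; lia].
Qed.

(** * The zeta word and its order ideal *)

(* The letter at the integer [t] in the bi-infinite version of the zeta word,
   which is read by decreasing [t]: the signed index [x] contributes a North
   step at [key x] and an East step at [key x - N]. *)
Definition north_at (t : int) : bool := t \in [seq key x | x <- sidx].
Definition east_at (t : int) : bool := north_at (t + N).
Definition letter (t : int) : step := if north_at t then North else East.

(** All integers strictly between [j N] and [(j + 1) N], downwards. The first half corresponds to
    [S_bwd_minus j], the second to [S_fwd_plus j]. *)
Definition block (j : nat) : seq int :=
  [seq j.+1%:Z * N + - i%:Z | i : nat <- iota 1 n]
  ++ [seq j%:Z * N + i%:Z | i : nat <- rev (iota 1 n)].

Definition events : seq int :=
  flatten [seq [seq t <- block j | north_at t || east_at t] | j <- rev (iota 0 n.+1)].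

Definition zeta_word : seq step := [seq letter t | t <- events].

Lemma north_at_lex a x : signed_index n x -> north_at (a * N + x) = (level x == a).
Proof. exact: mem_key. Qed.

Lemma east_at_lex a x : signed_index n x -> east_at (a * N + x) = (level x == a + 1).
Proof.
by move=> sx; rewrite /east_at (_ : _ + N = (a + 1) * N + x) ?north_at_lex //; ring.
Qed.

Lemma north_atP t : reflect (exists2 x, signed_index n x & t = key x) (north_at t).
Proof.
by apply: (iffP mapP) => -[x sx ->]; exists x; rewrite // ?mem_sidx // -mem_sidx.
Qed.

Lemma north_at_east_at t : north_at t -> ~~ east_at t.
Proof.
move=> /north_atP[x sx ->]; rewrite east_at_lex //; lia.
Qed.

Lemma letter_north t : (letter t == North) = north_at t.
Proof. by rewrite /letter; case: ifP. Qed.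

Lemma letter_east t : north_at t || east_at t -> (letter t == East) = east_at t.
Proof.
rewrite /letter; case: ifP => [/north_at_east_at/negbTE->|] //= _ ->.
Qed.

Lemma mem_block j t : reflect
  (exists2 x, signed_index n x & t = (if 0 < x then j%:Z else j.+1%:Z) * N + x) (t \in block j).
Proof.
rewrite mem_cat; apply: (iffP orP) => [[]/mapP[i]|[x sx ->]].
- rewrite mem_iota => i1 ->; exists (- i%:Z); first by rewrite /signed_index; lia.
  by rewrite (_ : 0 < - i%:Z = false) //; lia.
- rewrite mem_rev mem_iota => i1 ->; exists i%:Z; first by rewrite /signed_index; lia.
  by rewrite (_ : 0 < i%:Z) //; lia.
move: sx; rewrite /signed_index => sx; case: ifP => x0; [right|left]; apply/mapP.
  by exists `|x|%N; [rewrite mem_rev mem_iota|congr (_ + _)]; lia.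
by exists `|x|%N; [rewrite mem_iota|congr (_ + _)]; lia.
Qed.

Lemma block_bound j t : t \in block j -> j%:Z * N < t < j.+1%:Z * N.
Proof.
case/mem_block => x; rewrite /signed_index => sx ->; rewrite -[_ * N]addr0 -[X in _ < _ < X]addr0.
by rewrite !lex_lt //; [case: ifP; lia|lia..].
Qed.

Lemma block_sorted j : pairwise (fun s t => t < s) (block j).
Proof.
rewrite pairwise_cat; apply/and3P; split.
- apply/allrelP => x y /mapP[i]; rewrite mem_iota => i1 -> /mapP[k].
  by rewrite mem_rev mem_iota => k1 ->; rewrite lex_lt; lia.
- rewrite pairwise_map; apply: sub_pairwise (pairwise_iota 1 n) => x y /=.
  by rewrite ltrD2l; lia.
- rewrite pairwise_map pairwise_rev; apply: sub_pairwise (pairwise_iota 1 n) => x y /=.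
  by rewrite ltrD2l; lia.
Qed.

Lemma events_sorted : pairwise (fun s t => t < s) events.
Proof.
apply: (pairwise_flatten_map (q := fun i j : nat => (j < i)%N)).
- by rewrite pairwise_rev; exact: pairwise_iota.
- by move=> j _; apply: pairwise_filter; exact: block_sorted.
move=> i j s t ji; rewrite !mem_filter => /andP[_ /block_bound si] /andP[_ /block_bound tj].
have : j.+1%:Z * N <= i%:Z * N by rewrite ler_wpM2r; lia.
lia.
Qed.

Lemma uniq_events : uniq events.
Proof.
by apply: (@pairwise_uniq _ (fun s t => t < s)); [move=> t; rewrite /= ltxx|exact: events_sorted].
Qed.

Lemma mem_events (t : int) : (t \in events) = (0 < t) && (north_at t || east_at t).
Proof.
apply/flatten_mapP/andP => [[j _]|[t0 ev]].
  by rewrite mem_filter => /andP[-> /block_bound tj]; split=> //; nia.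
have [a [x [sx lx te]]] : exists a x : int,
    [/\ signed_index n x, a <= level x & t = a * N + x].
  case/orP: ev => /north_atP[x sx tx].
    by exists (level x), x; split.
  exists (level x - 1), x; split=> //; first by lia.
  by rewrite mulrBl addrAC; move: tx; rewrite /key; lia.
have a0 : 0 < a \/ (a = 0 /\ 0 < x).
  move: t0; rewrite te -[0 : int]addr0 -[X in X + 0](mul0r N) lex_lt //; last by case/andP: sx.
  by case/orP => [|/andP[/eqP <-]]; [left|right].
have lb := level_bound sx; move: (sx) => /andP[x0 xn].
(* A negative [x] moves [a N + x] below [a N], hence into block [a - 1]. *)
exists (if 0 < x then `|a|%N else `|a|.-1%N).
  by rewrite mem_rev mem_iota; case: ifP lb; lia.
rewrite mem_filter ev; apply/mem_block; exists x => //; rewrite te.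
by congr (_ * _ + _); case: (boolP (0 < x)) a0 lb => /= x_gt0; lia.
Qed.

Lemma count_letter a : count (fun t => letter t == a) events = count_mem a zeta_word.
Proof. by rewrite /zeta_word count_map. Qed.

(** Both lists are strictly decreasing and have the same elements. Thus the [k]-th North step occurs
    at the [k]-th largest key. *)
Lemma north_events : [seq t <- events | letter t == North] = [seq key x | x <- ranking & 0 < key x].
Proof.
apply: (@pairwise_eq _ (fun s t => t < s)).
- by move=> s t /andP[st ts]; move: (lt_trans st ts); rewrite ltxx.
- exact: pairwise_filter events_sorted.
- by rewrite pairwise_map; exact: pairwise_filter ranking_sorted.
apply: uniq_perm.
- exact: filter_uniq uniq_events.
- rewrite map_inj_in_uniq ?filter_uniq ?uniq_ranking // => x y.
  by rewrite !mem_filter !mem_ranking => /andP[_ sx] /andP[_ sy]; exact: key_inj.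
move=> t; rewrite mem_filter mem_events letter_north.
apply/andP/mapP => [[/north_atP[x sx ->] /andP[t0 _]]|[x]].
  by exists x; rewrite // mem_filter t0 mem_ranking.
rewrite mem_filter mem_ranking => /andP[x0 sx] ->.
have -> : north_at (key x) by apply/north_atP; exists x.
by rewrite x0.
Qed.

Lemma east_events : [seq t <- events | letter t == East] = [seq key x - N | x <- ranking & N < key x].
Proof.
apply: (@pairwise_eq _ (fun s t => t < s)).
- by move=> s t /andP[st ts]; move: (lt_trans st ts); rewrite ltxx.
- exact: pairwise_filter events_sorted.
- rewrite pairwise_map; apply: pairwise_filter; apply: sub_pairwise ranking_sorted.
  by move=> x y /=; rewrite ltrD2r.
apply: uniq_perm.
- exact: filter_uniq uniq_events.
- rewrite map_inj_in_uniq ?filter_uniq ?uniq_ranking // => x y.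
  by rewrite !mem_filter !mem_ranking => /andP[_ sx] /andP[_ sy] /addIr; exact: key_inj.
move=> t; rewrite mem_filter mem_events.
apply/andP/mapP => [[lt /andP[t0 ev]]|[x]].
  move: lt; rewrite letter_east // => /north_atP[x sx tx].
  by exists x; rewrite ?mem_filter ?mem_ranking ?sx ?andbT; lia.
rewrite mem_filter mem_ranking => /andP[x0 sx] ->.
have ea : east_at (key x - N) by apply/north_atP; exists x; rewrite ?subrK.
by rewrite letter_east ea ?orbT // subr_gt0 x0.
Qed.

Lemma count_key_gt (c : int) k : (0 < k)%N ->
  (k <= count (fun x => (c < key x)%R) ranking)%N = (k <= n.*2)%N && (c < key (ranked k)).
Proof.
case: k => // k _; rewrite (ltn_count_downset 0) ?size_ranking //.
by apply: sub_pairwise ranking_sorted => x y /= yx; apply/implyP => cy; exact: lt_trans yx.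
Qed.

Lemma filter_ranking (c : int) k : (0 < k <= count (fun x => (c < key x)%R) ranking)%N ->
  nth 0 [seq x <- ranking | c < key x] k.-1 = ranked k.
Proof.
move=> kc; rewrite filter_downset; first by rewrite nth_take //; case: k kc => // k /andP[].
by apply: sub_pairwise ranking_sorted => x y /= yx; apply/implyP => cy; exact: lt_trans yx.
Qed.

Lemma count_north : count_mem North zeta_word = count (fun x => 0 < key x) ranking.
Proof.
by rewrite -count_letter -size_filter north_events size_map size_filter.
Qed.

Lemma count_east : count_mem East zeta_word = count (fun x => N < key x) ranking.
Proof.
by rewrite -count_letter -size_filter east_events size_map size_filter.
Qed.

Lemma pos_north k : (0 < k <= count_mem North zeta_word)%N ->
  nth 0 events (pos North zeta_word k) = key (ranked k).
Proof.
move=> kc; rewrite pos_filter; last by rewrite count_letter.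
rewrite north_events; move: kc; rewrite count_north => kc.
by rewrite (nth_map 0) ?filter_ranking // size_filter; case: k kc => // k /andP[].
Qed.

Lemma pos_east k : (0 < k <= count_mem East zeta_word)%N ->
  nth 0 events (pos East zeta_word k) = key (ranked k) - N.
Proof.
move=> kc; rewrite pos_filter; last by rewrite count_letter.
rewrite east_events; move: kc; rewrite count_east => kc.
by rewrite (nth_map 0) ?filter_ranking // size_filter; case: k kc => // k /andP[].
Qed.

(** Events decrease along the word, so the earlier step sits at the larger integer; equal positions
    would carry two letters. *)
Lemma events_pos_lt i j : (0 < i <= count_mem East zeta_word)%N ->
  (0 < j <= count_mem North zeta_word)%N ->
  (pos East zeta_word i < pos North zeta_word j)%N = (key (ranked j) < key (ranked i) - N).
Proof.
move=> ie jn; rewrite -pos_north // -pos_east //.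
have [] := pos_mem ie; have [] := pos_mem jn; rewrite size_map.
set p := pos North _ _; set q := pos East _ _ => pe nN qe nE.
have /(pairwiseP 0) ev := events_sorted.
case: (ltngtP q p) => [qp|pq|qp].
- by rewrite ev.
- by apply/esym/negbTE; rewrite -leNgt ltW // ev.
- by rewrite qp nN in nE.
Qed.

(** An index [x] contributes an East step to the positive part exactly when [- x] contributes no
    North step to it. *)
Lemma count_east_north : (count_mem East zeta_word + count_mem North zeta_word = n.*2)%N.
Proof.
have iff k : (0 < k <= n.*2)%N ->
    (k <= count_mem East zeta_word)%N = (n.*2.+1 - k > count_mem North zeta_word)%N.
  move=> kn; rewrite ltnNge count_east count_north !count_key_gt ?rankedN //; try lia.
  rewrite keyN ?ranked_signed // subr_gt0.
  have := key_neq 1 (ranked_signed kn); rewrite mul1r; lia.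
have cE : (count_mem East zeta_word <= n.*2)%N.
  by rewrite count_east -size_ranking count_size.
have cN : (count_mem North zeta_word <= n.*2)%N.
  by rewrite count_north -size_ranking count_size.
(* The last East rank and the rank after it give the two inequalities. *)
have := iff (count_mem East zeta_word); have := iff (count_mem East zeta_word).+1.
lia.
Qed.

(** If [i + j > 2n + 1], then [key (ranked j)] is at most [N - key (ranked i)], which is negative
    for an East step of the word, whereas its North steps have positive keys. *)
Lemma zeta_valley_cell (i j : nat) : (i, j) \in valleys zeta_word ->
  cell n i j /\ key (ranked j) < key (ranked i) - N.
Proof.
have cEN := count_east_north.
have east_key k : (0 < k <= count_mem East zeta_word)%N -> N < key (ranked k).
  by move=> /andP[k0]; rewrite count_east count_key_gt // => /andP[].
have north_key k : (0 < k <= count_mem North zeta_word)%N -> 0 < key (ranked k).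
  by move=> /andP[k0]; rewrite count_north count_key_gt // => /andP[].
suff : [/\ (0 < i <= n.*2)%N, (0 < j <= n.*2)%N, (i + j <= n.*2.+1)%N
    & key (ranked j) < key (ranked i) - N] -> cell n i j /\ key (ranked j) < key (ranked i) - N.
  move=> red /mem_valleys[[i_n j_n pij]|[lE iE jE]]; apply: red.
    have ik := east_key i i_n; have jk := north_key j j_n.
    have ji : key (ranked j) < key (ranked i) - N by rewrite -events_pos_lt // pij.
    split=> //; [lia|lia|].
    have i2n : (0 < i <= n.*2)%N by lia.
    rewrite leqNgt; apply/negP => ij.
    have : key (ranked j) <= key (ranked (n.*2.+1 - i)) by rewrite ranked_le; lia.
    by rewrite rankedN // keyN ?ranked_signed //; lia.
  have cE0 : (0 < count_mem East zeta_word)%N.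
    rewrite -has_count; apply/hasP; exists (last North zeta_word); last by rewrite /= lE.
    by case: zeta_word lE => //= x s _; exact: mem_last.
  have iE0 : (0 < i <= count_mem East zeta_word)%N by rewrite iE cE0 /=.
  have i_n : (0 < i <= n.*2)%N by lia.
  (* The extra valley lies on the boundary of the cells, so that [ranked j] is [- ranked i]. *)
  have jE' : j = (n.*2.+1 - i)%N by lia.
  split; [lia|lia|lia|].
  by rewrite jE' rankedN // keyN ?ranked_signed //; have := east_key i iE0; lia.
move=> [i_n j_n ij_n ji]; split=> //; rewrite /cell ij_n andbT.
suff : (i < j)%N by lia.
by rewrite ltnNge -ranked_le // -ltNge; lia.
Qed.

(** Moving [i] up or [j] down in a cell only weakens the key inequality towards a valley; conversely
    [valley_below] supplies the valley, and the cell condition forces [N < key (ranked i)], so the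
    [i]-th East step does belong to the word. *)
Lemma zeta_valley_le (i j : nat) : cell n i j ->
  (exists2 y, y \in valley_roots n zeta_word & root_le y (alpha n i j)) <->
  key (ranked j) < key (ranked i) - N.
Proof.
move=> cij; have [i_n j_n ij_n] : [/\ (0 < i <= n.*2)%N, (0 < j <= n.*2)%N & (i + j <= n.*2.+1)%N].
  by move: cij; rewrite /cell; split; lia.
split=> [[y /imfsetP[[i' j'] /= v ->]]|ji].
  have [cij' ji'] := zeta_valley_cell v; rewrite root_le_alpha // => -[ii jj].
  have : key (ranked i') <= key (ranked i) by rewrite ranked_le //; move: cij'; rewrite /cell; lia.
  have : key (ranked j) <= key (ranked j') by rewrite ranked_le //; move: cij'; rewrite /cell; lia.
  lia.
have ki : N < key (ranked i).
  have : key (ranked (n.*2.+1 - i)) <= key (ranked j) by rewrite ranked_le //; lia.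
  rewrite rankedN // keyN ?ranked_signed //.
  have := key_neq 1 (ranked_signed i_n); rewrite mul1r; lia.
have iE : (0 < i <= count_mem East zeta_word)%N.
  by rewrite count_east count_key_gt ?ki; lia.
have [] := @valley_below zeta_word i j iE ltac:(lia).
  by move=> jN; rewrite events_pos_lt //; lia.
move=> i' [j' [v ii jj]]; have [cij' _] := zeta_valley_cell v.
exists (alpha n i' j'); last by apply/root_le_alpha.
by apply/imfsetP; exists (i', j').
Qed.

Lemma mem_order_ideal i j : cell n i j ->
  (alpha n i j \in order_ideal n zeta_word) = (key (ranked i) < key (ranked j) + N).
Proof.
move=> cij; rewrite in_fset inE /= alpha_pos_root //=.
have [si sj] : signed_index n (ranked i) /\ signed_index n (ranked j).
  by move: cij; rewrite /cell; split; apply: ranked_signed; lia.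
(* Equality would put both a North and an East step at [key (ranked j)]. *)
have ne : key (ranked i) != key (ranked j) + N.
  apply/eqP; rewrite /key => ne; have : east_at (key (ranked j)).
    by apply/north_atP; exists (ranked i).
  by apply/negP/north_at_east_at/north_atP; exists (ranked j).
by apply/asboolP/idP => [|lt /(zeta_valley_le cij)]; first rewrite zeta_valley_le //; lia.
Qed.

End SignedOrder.

(** * Counting attacking pairs *)

(** Counting [d x] and [d (f x)] together, each [x] contributes 1, or 2 if it is fixed by [f]. The
    right side does not depend on [d], so any two such choices of representatives have equal
    counts. *)
Lemma count_half (T : eqType) (s : seq T) (f : T -> T) (d : pred T) :
  perm_eq [seq f x | x <- s] s ->
  (forall x, x \in s -> d x || d (f x)) ->
  (forall x, x \in s -> d x -> d (f x) -> f x = x) ->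
  (count d s).*2 = (size s + count (fun x => f x == x) s)%N.
Proof.
move=> fs d_or d_and; rewrite -addnn -{2}(permP fs d) count_map -count_predUI.
congr (_ + _)%N.
  by rewrite -(count_predT s); apply: eq_in_count => x /d_or /= ->.
apply: eq_in_count => x xs /=; apply/andP/eqP => [[]|fx]; first exact: d_and.
by have := d_or x xs; rewrite fx orbb.
Qed.

Lemma card_ord_pos n (P : pred nat) :
  #|[set i : 'I_n.+1 | (0 < i)%N && P i]| = (\sum_(i <- iota 1 n) P i)%N.
Proof.
rewrite cardsE -sum1_card big_mkcond /= -(big_mkord xpredT (fun i => if (0 < i)%N && P i then 1%N else 0%N)).
rewrite big_ltn //= add0n /index_iota subSS subn0 !big_seq.
by apply: eq_bigr => i; rewrite mem_iota => /andP[-> _]; case: (P i).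
Qed.

Lemma num_pairsE n (P : nat -> nat -> bool) :
  num_pairs n P = (\sum_(i <- iota 1 n) \sum_(j <- iota 1 n) ((i < j) && P i j))%N.
Proof.
rewrite /num_pairs cardsE -sum1_card big_mkcond /=.
rewrite -(pair_big xpredT xpredT (fun i j : 'I_n.+1 => if (0 < i < j)%N && P i j then 1%N else 0%N)) /=.
pose F (i j : nat) := if (0 < i < j)%N && P i j then 1%N else 0%N.
rewrite (eq_bigr (fun i : 'I_n.+1 => \sum_(0 <= j < n.+1) F i j)%N); last by move=> i _; rewrite big_mkord.
rewrite -(big_mkord xpredT (fun i => \sum_(0 <= j < n.+1) F i j)%N).
rewrite big_ltn // big1 ?add0n // /index_iota subSS !subn0 [LHS]big_seq [RHS]big_seq.
apply: eq_bigr => i; rewrite mem_iota => /andP[i0 _]; rewrite big_cons {1}/F ltn0 andbF add0n.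
by apply: eq_bigr => j _; rewrite /F i0 /=; case: (_ && _).
Qed.

Section Attack.

Variables (n : nat) (m : nat -> int) (u : int -> int).
Hypothesis m_bound : forall i, (0 < i <= n)%N -> (`|m i| <= n)%N.
Hypothesis u_signed : forall x, signed_index n x -> signed_index n (u x).
Hypothesis uN : forall x, signed_index n x -> u (- x) = - u x.

Local Notation N := (n.*2.+1%:Z).
Local Notation level := (level m).
Local Notation key := (key n m).
Local Notation rank := (rank n m).
Local Notation ranked := (ranked n m).

Definition attack (x y : int) : bool := [&& key x < key y, key y < key x + N & u x < u y].

(** [key x + N] encodes the pair [(level x + 1, x)], so attacks join equal or consecutive levels, as
    in the terms of dinv. *)
Lemma attack_level x y : signed_index n x -> signed_index n y ->
  attack x y = ((level x == level y) && (x < y) || (level y == level x + 1) && (y < x))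
               && (u x < u y).
Proof.
move=> /andP[x0 xn] /andP[y0 yn]; rewrite /attack andbA; congr (_ && _).
rewrite (_ : key x + N = (level x + 1) * N + x); last by rewrite /key; ring.
by rewrite !lex_lt //; lia.
Qed.

Lemma attackN x y : signed_index n x -> signed_index n y ->
  attack (- y) (- x) = attack x y.
Proof.
move=> sx sy; rewrite /attack !keyN // !uN //; lia.
Qed.

Definition attacks : seq (int * int) :=
  [seq p <- [seq (x, y) | x <- sidx n, y <- sidx n] | attack p.1 p.2].

Lemma mem_attacks (p : int * int) :
  (p \in attacks) = [&& attack p.1 p.2, signed_index n p.1 & signed_index n p.2].
Proof.
case: p => x y; rewrite mem_filter /=; congr (_ && _).
apply/allpairsP/andP => [[[x' y'] /= []]|[sx sy]]; last by exists (x, y); rewrite /= !mem_sidx.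
by rewrite !mem_sidx => sx sy [-> ->].
Qed.

Lemma uniq_attacks : uniq attacks.
Proof.
by rewrite filter_uniq // allpairs_uniq ?uniq_sidx // => -[x y] [x' y'] /= _ _ [-> ->].
Qed.

Definition opp_swap (p : int * int) : int * int := (- p.2, - p.1).

Lemma opp_swapK : involutive opp_swap.
Proof. by case=> x y; rewrite /opp_swap /= !opprK. Qed.

Lemma perm_opp_swap : perm_eq [seq opp_swap p | p <- attacks] attacks.
Proof.
apply: uniq_perm; rewrite ?(map_inj_uniq (inv_inj opp_swapK)) ?uniq_attacks // => p.
rewrite -[p in LHS]opp_swapK (mem_map (inv_inj opp_swapK)) !mem_attacks /= !signed_indexN.
have [sx|] := boolP (signed_index n p.1); last by rewrite !andbF.
have [sy|] := boolP (signed_index n p.2); last by rewrite !andbF.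
by rewrite attackN.
Qed.

(** On signed indices this is [rank p.1 + rank p.2 <= 2n + 1], the bound in [cell], since
    [N - key p.1] is the key of [- p.1]. *)
Definition upper (p : int * int) : bool := N <= key p.1 + key p.2.

Lemma upper_attack_cell (p : int * int) : p \in attacks -> upper p -> cell n (rank p.2) (rank p.1).
Proof.
rewrite mem_attacks /upper => /and3P[/and3P[xy _ _] sx sy] up.
have rx := rank_bound m_bound sx; have ry := rank_bound m_bound sy.
have yx : (rank p.2 < rank p.1)%N by rewrite ltnNge rank_le // -ltNge.
have : (rank p.1 <= rank (- p.2))%N.
  rewrite rank_le ?signed_indexN // keyN //; lia.
by rewrite rankN // /cell; lia.
Qed.

(** The bijection sends [(x, y)] to the root [alpha n (rank y) (rank x)], the smaller key having the
    larger rank. The bound [key y < key x + N] is membership in the ideal, and [u x < u y] is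
    positivity of the image. *)
Lemma area'_attacks (w := of_window [seq u x | x <- window n m]) :
  area' n (zeta_word n m) w = count upper attacks.
Proof.
have act_alpha i j : cell n i j ->
    (act w (alpha n i j) \in pos_roots n) = (u (ranked j) < u (ranked i)).
  move=> cij; have [si sj _ ->] := alpha_cellE cij.
  have [i_n j_n] : (0 < i <= n.*2)%N /\ (0 < j <= n.*2)%N by move: cij; rewrite /cell; lia.
  have wN k : (0 < k <= n)%N -> w (- k%:Z) = - w k%:Z by case: k.
  rewrite actB !act_e // /w !window_rank_pos //.
  by rewrite mem_pos_roots_diff //; apply/u_signed/ranked_signed.
pose f (p : int * int) := alpha n (rank p.2) (rank p.1).
rewrite -size_filter -(size_map f) /area'; apply: perm_size; apply: uniq_perm.
- exact: fset_uniq.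
- rewrite map_inj_in_uniq ?(filter_uniq _ uniq_attacks) // => -[x y] [x' y'].
  rewrite mem_filter => /andP[up pa]; rewrite mem_filter => /andP[up' pa'].
  move/alpha_inj => /(_ (upper_attack_cell pa up) (upper_attack_cell pa' up')) /= [ry rx].
  move: pa pa'; rewrite !mem_attacks /= => /and3P[_ sx sy] /and3P[_ sx' sy'].
  by rewrite -(rankK m_bound sx) -(rankK m_bound sy) rx ry !rankK.
move=> r; rewrite in_fset inE /=; apply/andP/mapP => [[]|[p]].
  move=> rI rpos; have : r \in pos_roots n by move: rI; rewrite in_fset inE /= => /andP[].
  case/pos_rootsE => -[i j] /= cij er; move: rI rpos; rewrite {}er.
  rewrite mem_order_ideal // act_alpha // => kij uij.
  have [i_n j_n] : (0 < i <= n.*2)%N /\ (0 < j <= n.*2)%N by move: cij; rewrite /cell; lia.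
  have [si sj] := (ranked_signed m_bound i_n, ranked_signed m_bound j_n).
  exists (ranked j, ranked i); last by rewrite /f /= !rankedK.
  rewrite mem_filter mem_attacks /upper /attack /= kij uij si sj !andbT.
  apply/andP; split.
    have : (j <= n.*2.+1 - i)%N by move: cij; rewrite /cell; lia.
    by rewrite -(ranked_le m_bound) ?rankedN ?keyN //; [lia|move: cij; rewrite /cell; lia].
  by apply: ranked_lt => //; move: cij; rewrite /cell; lia.
rewrite mem_filter => /andP[up pa] ->; have cp := upper_attack_cell pa up.
move: pa; rewrite mem_attacks => /and3P[/and3P[_ k2 u12] sx sy].
by rewrite /f mem_order_ideal // act_alpha // !rankK.
Qed.

(* The representative of an [opp_swap]-orbit that the terms of dinv count. *)
Definition smaller_pos (p : int * int) : bool :=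
  if (`|p.1| <= `|p.2|)%N then 0 < p.1 else 0 < p.2.

(** Both predicates choose one element from each orbit of [opp_swap], so [count_half] gives the same
    value for both. *)
Lemma count_upper_smaller_pos : count upper attacks = count smaller_pos attacks.
Proof.
have fixed_eq (d : pred (int * int)) :
    (forall p, p \in attacks -> d p || d (opp_swap p)) ->
    (forall p, p \in attacks -> d p -> d (opp_swap p) -> opp_swap p = p) ->
    (count d attacks).*2 = (size attacks + count (fun p => opp_swap p == p) attacks)%N.
  by apply: count_half perm_opp_swap.
apply: double_inj; rewrite !fixed_eq // => -[x y]; rewrite mem_attacks /opp_swap /=.
- move=> /and3P[att sx sy]; move: att (sx) (sy); rewrite attack_level //.
  have lN := levelN m sx; rewrite /smaller_pos /signed_index /= !abszN.
  (* When [y = - x], equal levels are impossible by parity, so the attack has [level x = 0] and [x]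
     positive. *)
  by case: (y =P - x) => [->|yx]; [rewrite lN|]; case: ifP; case: ifP; lia.
- move=> /and3P[_ /andP[x0 xn] /andP[y0 yn]]; rewrite /smaller_pos /= !abszN.
  by do 2 case: ifP; move=> *; congr (_, _); lia.
- rewrite /upper /= => /and3P[_ sx sy]; rewrite !keyN //; lia.
- rewrite /upper /= => /and3P[_ sx sy]; rewrite !keyN // => up up'.
  have e_xy : key (- y) = key x by rewrite keyN //; lia.
  have <- : - y = x by apply: key_inj e_xy; rewrite ?signed_indexN.
  by rewrite opprK.
Qed.

(** The attacks split by signs: two positive indices give the first two terms, a positive one
    attacking a negative one the third and, on the diagonal, the fifth, a negative one attacking a
    positive one the fourth. Two negative indices are never chosen. *)
Lemma count_smaller_pos : count smaller_pos attacks =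
  (num_pairs n (fun i j => ((m i == m j) && (u i%:Z < u j%:Z))%R)
   + num_pairs n (fun i j => ((m i == m j + 1) && (u i%:Z > u j%:Z))%R)
   + num_pairs n (fun i j => ((m i == - m j) && (u i%:Z < - u j%:Z))%R)
   + num_pairs n (fun i j => ((m i == - m j + 1) && (u i%:Z > - u j%:Z))%R)
   + #|[set i : 'I_n.+1 | [&& (0 < i)%N, m i == 0 & (u (i : nat)%:Z < 0)%R]]|)%N.
Proof.
pose G x y : nat := attack x y && smaller_pos (x, y).
pose S (F : nat -> nat -> nat) : nat := (\sum_(i <- iota 1 n) \sum_(j <- iota 1 n) F i j)%N.
have S_swap F : S F = S (fun i j => F j i) by rewrite /S exchange_big.
have S_add F1 F2 : (S F1 + S F2)%N = S (fun i j => F1 i j + F2 i j)%N.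
  by rewrite /S -big_split; apply: eq_bigr => i _; rewrite -big_split.
have S_eq F1 F2 : (forall i j, (0 < i <= n)%N -> (0 < j <= n)%N -> F1 i j = F2 i j) -> S F1 = S F2.
  move=> eqF; rewrite /S big_seq [RHS]big_seq; apply: eq_bigr => i; rewrite mem_iota => i_n.
  rewrite big_seq [RHS]big_seq; apply: eq_bigr => j; rewrite mem_iota => j_n.
  by apply: eqF; lia.
have S_diag (F : nat -> bool) : (\sum_(i <- iota 1 n) F i)%N = S (fun i j => (i == j) && F i).
  rewrite /S big_seq [RHS]big_seq; apply: eq_bigr => i i_n.
  rewrite (bigD1_seq i) ?iota_uniq //= eqxx big1 ?addn0 // => j /negbTE ji.
  by rewrite eq_sym ji.
have sum_sidx (F : int -> nat) : (\sum_(x <- sidx n) F x =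
    \sum_(i <- iota 1 n) (F (- i%:Z)%R + F i%:Z))%N.
  rewrite big_cat !big_map big_split /=; congr (_ + _)%N.
  by apply: perm_big; rewrite perm_rev.
have -> : count smaller_pos attacks =
    S (fun i j => G (- i%:Z) (- j%:Z) + G (- i%:Z) j%:Z + (G i%:Z (- j%:Z) + G i%:Z j%:Z))%N.
  rewrite -sum1_count big_filter_cond big_mkcond big_allpairs /= sum_sidx.
  apply: eq_bigr => i _; rewrite !sum_sidx -big_split; apply: eq_bigr => j _ /=.
  by rewrite /G; do 4 case: (_ && _).
rewrite !num_pairsE (card_ord_pos n (fun i => (m i == 0) && (u i%:Z < 0))) S_diag.
rewrite -![(\sum_(_ <- _) \sum_(_ <- _) _)%N]/(S _).
(* In the second and fourth terms the attacked index is the smaller one in absolute value, so [i]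
   and [j] trade places. *)
rewrite [X in (_ + X + _ + _ + _)%N]S_swap [X in (_ + X + _)%N]S_swap !S_add.
apply: S_eq => i j i_n j_n.
have sk (k : nat) : (0 < k <= n)%N -> signed_index n k%:Z by rewrite /signed_index; lia.
have [si sj] := (sk _ i_n, sk _ j_n).
have [si' sj'] : signed_index n (- i%:Z) /\ signed_index n (- j%:Z) by rewrite !signed_indexN.
have lev (k : nat) : (0 < k <= n)%N -> level k%:Z = m k.
  by move=> /andP[k0 _]; rewrite /level absz_nat; case: ifP => //; lia.
rewrite /G !attack_level // !(@levelN n) // !lev // /smaller_pos /= !abszN !absz_nat !uN //.
have opp_gt0 k : (0 < - k%:Z) = false by lia.
have lt_opp k l : (0 < k <= n)%N -> (l%:Z < - k%:Z) = false by lia.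
have opp_lt k l : (0 < k <= n)%N -> (- k%:Z < l%:Z) = true by lia.
have gt0 (k : nat) : (0 < k <= n)%N -> (0 < k%:Z) = true by lia.
rewrite !opp_gt0 !lt_opp // !opp_lt // !gt0 //.
have -> : (1 - m j == m i + 1) = (m i == - m j) by clear; lia.
have -> : (1 - m i == m j) = (m j == - m i + 1) by clear; lia.
rewrite !ltz_nat; case: (ltngtP i j) => [_|_|<-] /=; rewrite ?ltxx ?andbF ?andbT ?orbF ?addn0 ?add0n.
- by rewrite addnC.
- by rewrite addnC.
have -> : (m i == - m i) = (m i == 0) by clear; lia.
by have -> : (u i < - u i) = (u i < 0) by clear; lia.
Qed.

End Attack.

(** * The zeta map and d_C expressed through keys *)

Section Link.

Variables (n : nat) (pi : seq step).

Let m (i : nat) : int := mu n pi (n.+1 - i).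

Lemma rev_mu_seq : rev (mu_seq n pi) = [seq m i | i <- iota 1 n].
Proof.
apply: (@eq_from_nth _ 0); first by rewrite size_rev !size_map.
move=> k; rewrite size_rev size_map size_iota => kn.
rewrite nth_rev ?size_map ?size_iota // !(nth_map 0%N) ?size_iota ?nth_iota //; try lia.
by rewrite /m; congr (mu _ _ _); lia.
Qed.

Lemma mu_seqE : mu_seq n pi = [seq m i | i <- rev (iota 1 n)].
Proof. by rewrite map_rev -rev_mu_seq revK. Qed.

(** In block [j], the offset [- i] has a North step when [1 - m i = j + 1] and an East step when
    [1 - m i = j + 2], that is, [m i = - j] and [m i = - j - 1]; the offset [i] has them for
    [m i = j] and [m i = j + 1]. *)
Lemma zetaC_zeta_word : zetaC n pi = zeta_word n m.
Proof.
rewrite /zetaC /zeta_word /events map_flatten -map_comp; congr flatten.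
apply: eq_map => j /=; rewrite filter_cat map_cat; congr (_ ++ _).
  rewrite /S_bwd_minus rev_mu_seq /read_word !filter_map -!map_comp.
  have iota_lex i : i \in iota 1 n -> signed_index n (- i%:Z) /\ level m (- i%:Z) = 1 - m i.
    rewrite mem_iota => i1; have si : signed_index n i%:Z by rewrite /signed_index; lia.
    by rewrite signed_indexN (levelN _ si) /level (_ : 0 < i%:Z) //; lia.
  rewrite [in RHS](eq_in_filter (a2 := fun i => (m i == - j%:Z) || (m i == - j%:Z - 1))).
    apply/eq_in_map => i; rewrite mem_filter => /andP[_ /iota_lex[si li]] /=.
    rewrite /letter north_at_lex // li; congr (if _ then _ else _); lia.
  move=> i /iota_lex[si li]; rewrite /preim /= north_at_lex // east_at_lex // li; lia.
have iota_lex i : i \in rev (iota 1 n) -> signed_index n i%:Z /\ level m i%:Z = m i.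
  rewrite mem_rev mem_iota => i1; split; first by rewrite /signed_index; lia.
  by rewrite /level (_ : 0 < i%:Z) //; lia.
rewrite /S_fwd_plus mu_seqE /read_word !filter_map -!map_comp.
rewrite [in RHS](eq_in_filter (a2 := fun i => (m i == j%:Z) || (m i == j.+1%:Z))).
  apply/eq_in_map => i; rewrite mem_filter => /andP[_ /iota_lex[si li]] /=.
  by rewrite /letter north_at_lex // li.
by move=> i /iota_lex[si li]; rewrite /preim /= north_at_lex // east_at_lex // li; lia.
Qed.

(** The index [- j] has level [i + 1] exactly when [m j = - i], and oddness turns [- u j] into
    [u (- j)]. *)
Lemma dC_window_map (u : int -> int) : (forall x, signed_index n x -> u (- x) = - u x) ->
  dC_window n pi u = [seq u x | x <- window n m].
Proof.
move=> uN; rewrite /dC_window /window map_flatten -map_comp; congr flatten.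
apply: eq_map => i /=; rewrite /sidx filter_cat map_cat !filter_map -!map_comp.
congr (_ ++ _).
  rewrite [in RHS](eq_in_filter (a2 := fun j : nat => m j == - i%:Z)); last first.
    move=> j; rewrite mem_rev mem_iota => j1; rewrite -[LHS]/(level m (- j%:Z) == i.+1%:Z).
    rewrite (@levelN n) ?/signed_index; last by lia.
    by rewrite /level (_ : 0 < j%:Z) /=; lia.
  apply/esym/eq_in_map => j; rewrite mem_filter mem_rev mem_iota => /andP[_ j1] /=.
  by apply: uN; rewrite /signed_index; lia.
rewrite [in RHS](eq_in_filter (a2 := fun j : nat => m j == i.+1%:Z)) // => j.
by rewrite mem_iota => j1 /=; rewrite /level (_ : 0 < j%:Z) //; lia.
Qed.

(** Both terms of [m i = i - lam pi i] lie between 0 and [n]. *)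
Lemma mu_bound i : lattice_word n pi -> (0 < i <= n)%N -> (`|m i| <= n)%N.
Proof.
move=> /andP[_ /eqP cE] i_n; rewrite /m /mu.
have -> : (n.+1 - (n.+1 - i) = i)%N by lia.
have : (lam pi i <= n)%N by rewrite -cE; apply/leq_count_subseq/take_subseq.
lia.
Qed.

End Link.

Lemma signed_rangeP n x : signed_range n x <-> signed_index n x.
Proof. by []. Qed.

Theorem theorem4p29 (n : nat) (pi : seq step) (u : int -> int)
    (n_ge1 : (1 <= n)%N) (pi_u_Vert : VertC n pi u) :
  dinvC' n pi u = area' n (zetaC n pi) (dC n pi u).
Proof.
case: pi_u_Vert => lw [[u_range _ _] uN] _ _.
have u_signed x : signed_index n x -> signed_index n (u x).
  by move=> /signed_rangeP/u_range/signed_rangeP.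
have u_odd x : signed_index n x -> u (- x) = - u x by move=> /signed_rangeP/uN.
have m_bound i := @mu_bound n pi i lw.
rewrite zetaC_zeta_word /dC dC_window_map // area'_attacks // count_upper_smaller_pos //.
rewrite count_smaller_pos // /dinvC'.
have mE (i : 'I_n.+1) : (0 < i)%N -> mu n pi (n - i + 1) = mu n pi (n.+1 - i).
  by move=> i0; congr (mu _ _ _); have := ltn_ord i; lia.
have npE (P Q : nat -> nat -> bool) :
    (forall i j : 'I_n.+1, (0 < i < j)%N -> P i j = Q i j) -> num_pairs n P = num_pairs n Q.
  move=> PQ; apply: eq_card => -[i j]; rewrite !inE /=.
  by case: (boolP (0 < i < j)%N) => // /PQ.
congr (_ + _ + _ + _ + _)%N.
1-4: by apply: npE => i j ij; rewrite !mE //; lia.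
by apply: eq_card => i; rewrite !inE; case: (posnP i) => // i0; rewrite mE.
Qed.
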